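(* There exists no $X \subseteq S^9$ such that $A(X) \subseteq \{\pm\frac{1}{5}, \pm\frac{3}{5}\}$, $|X| \ge 256$, and $X$ contains a special triangle (that is, there are $x_1,x_2,x_3 \in X \cup (-X)$ with $(x_1,x_2) = (x_2,x_3) = \frac{3}{5}$ and $(x_1,x_3) = -\frac{1}{5}$).
   Context: $S^{n-1}$ is the unit sphere of $\mathbb{R}^n$ and $(\cdot,\cdot)$ the standard inner product. For $X \subseteq \mathbb{R}^n$, $A(X) := \{(x,x') \mid x,x' \in X,\ x \neq x'\}$. *)

(* Defs.v *)
From mathcomp Require Import all_boot all_order all_algebra.
From mathcomp Require Import all_classical all_reals.

Set Implicit Arguments.
Unset Strict Implicit.
Unset Printing Implicit Defensive.

Import Order.TTheory GRing.Theory Num.Theory.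
Local Open Scope classical_set_scope.
Local Open Scope ring_scope.

Definition inner (R : realType) (n : nat) (x y : 'rV[R]_n) : R :=
  \sum_(i < n) x 0 i * y 0 i.

(* The norm that the library attaches to row vectors is the sup norm. *)
Definition enorm (R : realType) (n : nat) (x : 'rV[R]_n) : R :=
  Num.sqrt (inner x x).

(* [unit_sphere R n] lives in R^n, so S^9 is [unit_sphere R 10]. *)
Definition unit_sphere (R : realType) (n : nat) : set 'rV[R]_n :=
  [set x | enorm x = 1].
Arguments unit_sphere : clear implicits.

Definition inner_products (R : realType) (n : nat) (X : set 'rV[R]_n) : set R :=
  [set a | exists x y, [/\ X x, X y, x <> y & a = inner x y]].

Definition contains_special_triangle (R : realType) (n : nat)
    (X : set 'rV[R]_n) : Prop :=
  let Y := X `|` [set - x | x in X] in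
  exists x1 x2 x3, [/\ Y x1, Y x2 & Y x3] /\
    [/\ inner x1 x2 = 3 / 5, inner x2 x3 = 3 / 5 & inner x1 x3 = - (1 / 5)].

(* Main.v *)
Require Import Defs.
From mathcomp Require Import all_boot all_order all_algebra.
From mathcomp Require Import all_classical all_reals.
From mathcomp Require Import zify ring lra.
Import Order.TTheory GRing.Theory Num.Theory.
Local Open Scope classical_set_scope.
Local Open Scope ring_scope.

(** Let [x1, x2, x3] be a special triangle and [t = x1 - x2 + x3], so that
    [(t, t) = 1/5]. For [y] in [X] the number [5 (y, t)] is an odd integer of
    absolute value at most [sqrt 5], hence [(y, t) = 1/5] or [-1/5]. Replacing
    [y] by [-y] if needed, [u = y - t] is orthogonal to [t] and [(u, u) = 4/5],
    and distinct points of [X] give vectors with normalised inner products in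
    [{-1, -1/2, 0, 1/2}]. In the 9-dimensional space [t^⊥] the Delsarte linear
    programming bound, with a test polynomial of degree 6 equal to a negative
    constant at these four values, shows that there are at most 252 of them. *)

(** * Gegenbauer polynomials and their addition theorem *)

(* The monic Gegenbauer polynomial of degree [k] (for [k <= 6]) of the sphere
   in dimension [n], homogenised: [s] stands for [(u, v)] and [p] for
   [(u, u) (v, v)]. *)
Definition gegenbauer (F : fieldType) (n : F) (k : nat) (s p : F) : F :=
  match k with
  | 0 => 1
  | 1 => s
  | 2 => s ^+ 2 - p / n
  | 3 => s ^+ 3 - 3 / (n + 2) * p * s
  | 4 => s ^+ 4 - 6 / (n + 4) * p * s ^+ 2 + 3 / ((n + 2) * (n + 4)) * p ^+ 2
  | 5 => s ^+ 5 - 10 / (n + 6) * p * s ^+ 3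
         + 15 / ((n + 4) * (n + 6)) * p ^+ 2 * s
  | 6 => s ^+ 6 - 15 / (n + 8) * p * s ^+ 4
         + 45 / ((n + 6) * (n + 8)) * p ^+ 2 * s ^+ 2
         - 15 / ((n + 4) * (n + 6) * (n + 8)) * p ^+ 3
  | _ => 0
  end.

(** Constants of the Gegenbauer addition theorem in the monic normalisation. The truncated
    predecessor leaves an empty denominator at [k = j = 0]. *)
Definition addition_coef (F : fieldType) (n : F) (k j : nat) : F :=
  'C(k, j)%:R * (\prod_(1 <= i < k) (n + 2 * i%:R - 1))
  * (\prod_(0 <= i < j) (n + 2 * i%:R))
  / \prod_(0 <= i < (k + j).-1) (n + i%:R).

Lemma addition_coef_ge0 (F : realFieldType) (n : F) (k j : nat) :
  1 <= n -> 0 <= addition_coef F n k j.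
Proof.
move=> n1; rewrite /addition_coef !mulr_ge0 ?invr_ge0 //.
- rewrite big_nat; apply: prodr_ge0 => i /andP[i1 _].
  have : 1 <= i%:R :> F by rewrite ler1n.
  lra.
- by apply: prodr_ge0 => i _; have := ler0n F i; lra.
- by apply: prodr_ge0 => i _; have := ler0n F i; lra.
Qed.

(* The addition theorem, for vectors [(x, u)] and [(y, v)] of dimension [n + 1]
   with [s = (u, v)], [A = (u, u)] and [B = (v, v)]. *)
Lemma gegenbauer_addition (F : realFieldType) (n x y s A B : F) (k : nat) :
  1 <= n -> (k <= 6)%N ->
  gegenbauer F (n + 1) k (x * y + s) ((x ^+ 2 + A) * (y ^+ 2 + B)) =
  \sum_(0 <= j < k.+1) addition_coef F n k j
     * gegenbauer F (n + 1 + 2 * j%:R) (k - j) x (x ^+ 2 + A)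
     * gegenbauer F (n + 1 + 2 * j%:R) (k - j) y (y ^+ 2 + B)
     * gegenbauer F n j s (A * B).
Proof.
move=> n1 k6.
(* For each of the seven degrees the unrolled sum is an identity of rational functions, with
   denominators positive since [1 <= n]. *)
case: k k6 => [|[|[|[|[|[|[|k]]]]]]] // _;
  rewrite /addition_coef unlock /= /subn /binomial /= /addn /=.
all: field => //.
all: repeat (apply/andP; split); apply: lt0r_neq0; lra.
Qed.

(** * Inner products and reflections *)

Lemma innerC (R : realType) (n : nat) (x y : 'rV[R]_n) : inner x y = inner y x.
Proof. by apply: eq_bigr => i _; rewrite mulrC. Qed.

Lemma innerDl (R : realType) (n : nat) (x y z : 'rV[R]_n) :
  inner (x + y) z = inner x z + inner y z.
Proof.
by rewrite -big_split; apply: eq_bigr => i _; rewrite mxE mulrDl.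
Qed.

Lemma innerZl (R : realType) (n : nat) (a : R) (x z : 'rV[R]_n) :
  inner (a *: x) z = a * inner x z.
Proof. by rewrite mulr_sumr; apply: eq_bigr => i _; rewrite mxE mulrA. Qed.

Lemma innerNl (R : realType) (n : nat) (x z : 'rV[R]_n) :
  inner (- x) z = - inner x z.
Proof. by rewrite -scaleN1r innerZl mulN1r. Qed.

Lemma innerDr (R : realType) (n : nat) (x y z : 'rV[R]_n) :
  inner z (x + y) = inner z x + inner z y.
Proof. by rewrite innerC innerDl !(innerC _ _ z). Qed.

Lemma innerZr (R : realType) (n : nat) (a : R) (x z : 'rV[R]_n) :
  inner z (a *: x) = a * inner z x.
Proof. by rewrite innerC innerZl innerC. Qed.

Lemma innerNr (R : realType) (n : nat) (x z : 'rV[R]_n) :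
  inner z (- x) = - inner z x.
Proof. by rewrite innerC innerNl innerC. Qed.

Definition innerE := (innerDl, innerDr, innerNl, innerNr, innerZl, innerZr).

Lemma inner_ge0 (R : realType) (n : nat) (x : 'rV[R]_n) : 0 <= inner x x.
Proof. by apply: sumr_ge0 => i _; rewrite -expr2 sqr_ge0. Qed.

(** Cauchy-Schwarz: the component of [y] orthogonal to the unit vector [x] has nonnegative square
    norm. *)
Lemma inner_sqr_le (R : realType) (n : nat) (x y : 'rV[R]_n) :
  inner x x = 1 -> inner x y ^+ 2 <= inner y y.
Proof.
move=> xx; have := inner_ge0 R n (y - inner x y *: x).
rewrite !innerE xx (innerC _ _ y x); lra.
Qed.

Lemma inner_eq0 (R : realType) (n : nat) (x : 'rV[R]_n) :
  inner x x = 0 -> x = 0.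
Proof.
move=> /psumr_eq0P x0; apply/rowP => i; rewrite mxE.
have /eqP := x0 (fun i _ => sqr_ge0 (x 0 i)) i isT.
by rewrite mulf_eq0 orbb => /eqP.
Qed.

Lemma inner_delta (R : realType) (n : nat) (x : 'rV[R]_n) (i : 'I_n) :
  inner x (delta_mx 0 i) = x 0 i.
Proof.
rewrite /inner (bigD1 i) //= mxE !eqxx mulr1 big1 ?addr0 // => j /negbTE ji.
by rewrite mxE ji andbF mulr0.
Qed.

Definition row_tail (R : realType) (n : nat) (x : 'rV[R]_n.+1) : 'rV[R]_n :=
  \row_i x 0 (lift ord0 i).

Lemma inner_recl (R : realType) (n : nat) (x y : 'rV[R]_n.+1) :
  inner x y = x 0 0 * y 0 0 + inner (row_tail R n x) (row_tail R n y).
Proof.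
rewrite /inner big_ord_recl; congr (_ + _).
by apply: eq_bigr => i _; rewrite !mxE.
Qed.

Lemma inner_reflection (R : realType) (n : nat) (w x y : 'rV[R]_n) :
  inner (x - (2 * inner x w / inner w w) *: w)
        (y - (2 * inner y w / inner w w) *: w) = inner x y.
Proof.
have [w0|wn0] := eqVneq (inner w w) 0.
  by rewrite (inner_eq0 _ _ _ w0) !scaler0 !subr0.
by rewrite !innerE (innerC _ _ w y); field.
Qed.

(* The reflection exchanging [t] and [|t| e_0] maps [t^⊥] to [e_0^⊥]; when these
   two vectors coincide, [x / 0 = 0] turns the formula into the identity. *)
Lemma isometry_orthogonal (R : realType) (n : nat) (t : 'rV[R]_n.+1) :
  t != 0 -> exists f : 'rV[R]_n.+1 -> 'rV[R]_n,
    forall x y, inner x t = 0 -> inner y t = 0 -> inner (f x) (f y) = inner x y.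
Proof.
move=> t0; pose a := enorm t.
have a2 : a ^+ 2 = inner t t by rewrite sqr_sqrtr ?inner_ge0.
have an0 : a != 0.
  by apply/eqP => a0; move/eqP: t0; apply; apply: inner_eq0; rewrite -a2 a0 expr0n.
pose w := t - a *: delta_mx 0 0.
have dot_w x : inner x w = inner x t - a * x 0 0.
  by rewrite !innerE inner_delta.
have ww : inner w w = 2 * a * (a - t 0 0).
  rewrite dot_w innerC dot_w /w !mxE eqxx -a2 /=; ring.
pose h x := x - (2 * inner x w / inner w w) *: w.
have h0 x : inner x t = 0 -> h x 0 0 = 0.
  move=> xt; have [w0|wn0] := eqVneq (inner w w) 0.
    have x0 : x 0 0 = 0.
      have := dot_w x; rewrite (inner_eq0 _ _ _ w0) xt sub0r innerC.
      rewrite -(scale0r 0) innerZl mul0r => /esym/eqP.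
      by rewrite oppr_eq0 mulf_eq0 (negbTE an0) => /eqP.
    by rewrite /h (inner_eq0 _ _ _ w0) scaler0 subr0.
  have := wn0; rewrite ww => wn0'.
  rewrite /h !mxE eqxx dot_w xt ww /=; field.
  by move: wn0'; rewrite !mulf_eq0 !negb_or => /andP[/andP[_ ->] ->].
(* Reflected vectors have coordinate 0 equal to zero, so dropping it loses nothing. *)
exists (fun x => row_tail R n (h x)) => x y xt yt.
by rewrite -(inner_reflection _ _ w) inner_recl h0 // mul0r add0r.
Qed.

(** * Positive definiteness and the linear programming bound *)

(** Schoenberg's theorem, by induction on the dimension: the addition theorem splits off coordinate
    0, leaving a nonnegative combination of kernels in the tails. *)
Lemma gegenbauer_psd (R : realType) (n k : nat) (I : finType) (c : I -> R)
    (u : I -> 'rV[R]_n.+1) : (k <= 6)%N ->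
  0 <= \sum_i \sum_j c i * c j * gegenbauer R n.+1%:R k
         (inner (u i) (u j)) (inner (u i) (u i) * inner (u j) (u j)).
Proof.
elim: n k c u => [|n IHn] k c u k6.
  pose x i := u i 0 0.
  have dot i j : inner (u i) (u j) = x i * x j by rewrite /inner big_ord1.
  have sq (d : I -> R) : 0 <= \sum_i \sum_j d i * d j.
    by have := sqr_ge0 (\sum_i d i); rewrite expr2 big_distrlr.
  case: k k6 => [|[|k]] k6.
  - by under eq_bigr do under eq_bigr do rewrite mulr1.
  - under eq_bigr do under eq_bigr do rewrite /= dot mulrACA.
    exact: (sq (fun i => c i * x i)).
  (* In dimension 1 one has [p = s ^+ 2], where the polynomials of degree 2 to 6 vanish. *)
  - rewrite big1 // => i _; rewrite big1 // => j _; rewrite !dot.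
    by case: k k6 => [|[|[|[|[|k]]]]] // _ /=; field.
have n1 : 1 <= n.+1%:R :> R by rewrite ler1n.
pose P j i := gegenbauer R (n.+1%:R + 1 + 2 * j%:R) (k - j)
                (u i 0 0) (inner (u i) (u i)).
pose v i := row_tail R n.+1 (u i).
have dot i j : inner (u i) (u j) = u i 0 0 * u j 0 0 + inner (v i) (v j).
  exact: inner_recl.
rewrite -[n.+2%:R]natr1.
(* The factors [P l i] and [P l j] are absorbed into the weights [c], giving the form of the
   induction hypothesis. *)
rewrite (eq_bigr (fun i => \sum_(0 <= l < k.+1) \sum_j addition_coef R n.+1%:R k l *
  ((c i * P l i) * (c j * P l j) * gegenbauer R n.+1%:R l (inner (v i) (v j))
     (inner (v i) (v i) * inner (v j) (v j))))); last first.
  move=> i _; rewrite exchange_big; apply: eq_bigr => j _.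
  rewrite /P !dot -!expr2 gegenbauer_addition // mulr_sumr.
  by apply: eq_bigr => l _; ring.
rewrite exchange_big big_nat; apply: sumr_ge0 => l /andP[_ lk].
under eq_bigr do rewrite -mulr_sumr.
rewrite -mulr_sumr mulr_ge0 ?addition_coef_ge0 // (IHn l (fun i => c i * P l i)) //.
by rewrite (leq_trans _ k6).
Qed.

(* Test polynomial: with [Q_k] the Gegenbauer polynomials of dimension 9, the
   weights below on [Q_1, Q_3, Q_4, Q_6] are those for which the weighted sum is
   [-1] at each of [-1, -1/2, 0, 1/2]; it is then [251 + 6/17] at [1]. *)
Lemma delsarte_bound (R : realType) (I : finType) (q : R) (u : I -> 'rV[R]_9) :
  0 < q -> (forall i, inner (u i) (u i) = q) ->
  (forall i j, i != j ->
     [\/ inner (u i) (u j) = - q, inner (u i) (u j) = - (q / 2),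
         inner (u i) (u j) = 0 | inner (u i) (u j) = q / 2]) ->
  (#|I| <= 252)%N.
Proof.
move=> q0 uu uv; have qn0 : q != 0 by rewrite gt_eqF.
pose Q k i j := gegenbauer R 9%:R k
  (inner (u i) (u j)) (inner (u i) (u i) * inner (u j) (u j)).
(* [Q k] is homogeneous of degree [k] in [q]; dividing by [q ^+ k] rescales to unit vectors. *)
pose f i j := (5 * 13 / 17) / q * Q 1 i j
  + (4 * 5 * 11 * 13 / 17) / q ^+ 3 * Q 3 i j
  + (5 * 11 * 13 ^+ 2 / 17 ^+ 2) / q ^+ 4 * Q 4 i j
  + (4 * 11 ^+ 2 * 13 / 17) / q ^+ 6 * Q 6 i j.
have fsum : 0 <= \sum_i \sum_j f i j.
  have psd k w : (k <= 6)%N -> 0 <= w -> 0 <= \sum_i \sum_j w * Q k i j.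
    move=> k6 w0; under eq_bigr do rewrite -mulr_sumr.
    rewrite -mulr_sumr mulr_ge0 //.
    have := gegenbauer_psd R 8 k I (fun=> 1) u k6.
    by under eq_bigr do under eq_bigr do rewrite !mul1r.
  under eq_bigr do rewrite !big_split.
  rewrite !big_split !addr_ge0 // psd // divr_ge0 ?exprn_ge0 ?(ltW q0) //; lra.
have fii i : f i i = 251 + 6 / 17 by rewrite /f /Q /= !uu; field.
have fij i j : i != j -> f i j = - 1.
  by rewrite /f /Q /= !uu => /uv[] ->; field.
have rowE i : \sum_j f i j = 251 + 6 / 17 - (#|I|%:R - 1).
  rewrite (bigD1 i) //= fii (eq_bigr (fun=> - 1)) => [|j]; last first.
    by rewrite eq_sym => /fij.
  rewrite sumr_const cardC1 -mulr_natr.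
  have /prednK <- : (0 < #|I|)%N by apply/card_gt0P; exists i.
  by rewrite -natr1 /=; ring.
have [I0|/card_gt0P[i _]] := posnP #|I|; first by rewrite I0.
move: fsum; under eq_bigr do rewrite rowE.
rewrite sumr_const pmulrn_lge0; last by apply/card_gt0P; exists i.
(* Each row sums to [252 + 6 / 17 - #|I|], which the nonnegative total forces to be nonnegative. *)
move=> le; have : #|I|%:R < 253%:R :> R by lra.
by rewrite ltr_nat.
Qed.

(** * From a special triangle to the bound *)

Lemma sqr_odd_le5 (R : realType) (m : int) :
  (2 * m%:~R + 1) ^+ 2 <= 5 :> R -> (2 * m%:~R + 1) ^+ 2 = 1 :> R.
Proof.
have E : (2 * m%:~R + 1) ^+ 2 = ((2 * m + 1) ^+ 2)%:~R :> R.
  by rewrite rmorphXn rmorphD rmorphM.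
rewrite E (_ : 5 = 5%:~R) // ler_int => le5.
(* The odd square after 1 is 9, so only the odd numbers 1 and -1 remain. *)
have : m = 0 \/ m = -1 by nia.
by case=> ->.
Qed.

Theorem proposition7p3 (R : realType) :
  ~ exists X : set 'rV[R]_10,
    [/\ X `<=` unit_sphere R 10,
        inner_products X `<=` [set 1 / 5; - (1 / 5); 3 / 5; - (3 / 5)],
        (`I_256 #<= X)%card
      & contains_special_triangle X].
Proof.
move=> [X [Xsphere Xinner X256 [x1 [x2 [x3 [[Yx1 Yx2 Yx3] [x12 x23 x13]]]]]]].
have Xnorm x : X x -> inner x x = 1.
  move=> /Xsphere /(congr1 (fun z => z ^+ 2)).
  by rewrite sqr_sqrtr ?inner_ge0 // expr1n.
have Xdot x y : X x -> X y -> x != y ->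
    [\/ inner x y = 1 / 5, inner x y = - (1 / 5),
        inner x y = 3 / 5 | inner x y = - (3 / 5)].
  move=> Xx Xy /eqP xy.
  have : inner_products X (inner x y) by exists x, y.
  move=> /Xinner [[[]|]|]; [exact: Or41|exact: Or42|exact: Or43|exact: Or44].
have Xodd x y : X x -> X y -> exists m : int, 5 * inner x y = 2 * m%:~R + 1.
  move=> Xx Xy; have [->|/(Xdot _ _ Xx Xy)[] ->] := eqVneq x y.
  - by exists 2; rewrite Xnorm //; lra.
  - by exists 0; lra.
  - by exists (-1); lra.
  - by exists 1; lra.
  - by exists (-2); lra.
have Yodd x y : X x -> (X `|` [set - z | z in X]) y ->
    exists m : int, 5 * inner x y = 2 * m%:~R + 1.
  move=> Xx [/(Xodd _ _ Xx)//|[z Xz <-]].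
  have [m mE] := Xodd x z Xx Xz; exists (- m - 1).
  rewrite innerNr mulrN mE rmorphB rmorphN /=; ring.
have Ynorm y : (X `|` [set - z | z in X]) y -> inner y y = 1.
  by case=> [/Xnorm//|[z /Xnorm zz <-]]; rewrite !innerE opprK.
pose t := x1 - x2 + x3.
have tt : inner t t = 1 / 5.
  rewrite !innerE (innerC _ _ x2 x1) (innerC _ _ x3 x1) (innerC _ _ x3 x2).
  rewrite x12 x23 x13 !Ynorm //; lra.
have Xt y : X y -> inner y t = 1 / 5 \/ inner y t = - (1 / 5).
  move=> Xy; have [m1 m1E] := Yodd y x1 Xy Yx1.
  have [m2 m2E] := Yodd y x2 Xy Yx2; have [m3 m3E] := Yodd y x3 Xy Yx3.
  (* An alternating sum of three odd numbers is odd. *)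
  have ytE : 5 * inner y t = 2 * (m1 - m2 + m3)%:~R + 1.
    by rewrite !innerE rmorphD rmorphB /=; lra.
  have le5 : (5 * inner y t) ^+ 2 <= 5.
    have := inner_sqr_le R _ y t (Xnorm y Xy); rewrite tt exprMn; lra.
  have : (5 * inner y t) ^+ 2 = 1.
    by move: le5; rewrite ytE; exact: sqr_odd_le5.
  move/eqP; rewrite sqrf_eq1 => /orP[] /eqP h; [left|right]; lra.
clearbody t.
have [g gX g_inj] : exists2 g : 'I_256 -> 'rV[R]_10, forall i, X (g i) & injective g.
  move/card_leP: X256 => [h].
  have lt256 (i : 'I_256) : (i : nat) \in `I_256 by rewrite inE /= ltn_ord.
  exists (fun i => val (h (SigSub (lt256 i)))) => [i|i j]; first exact: set_valP.
  by move=> /val_inj /inj; rewrite !in_setT => /(_ isT isT) [] /val_inj.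
pose e i : R := if inner (g i) t == 1 / 5 then 1 else - 1.
have eP i : (e i = 1 \/ e i = - 1) /\ e i * inner (g i) t = 1 / 5.
  rewrite /e; have [-> | ne] := eqVneq; first by split; [left|lra].
  by split; [right|case: (Xt _ (gX i)) => E; [rewrite E eqxx in ne|lra]].
(* The sign makes [(e i *: g i, t) = 1/5 = (t, t)], whence orthogonality to [t]. *)
pose u i := e i *: g i - t.
have ut i : inner (u i) t = 0 by rewrite !innerE tt; have [_ ->] := eP i; lra.
have uE i j : inner (u i) (u j) = e i * e j * inner (g i) (g j) - 1 / 5.
  rewrite innerDr innerNr ut /u !innerE (innerC _ _ t (g j)).
  by have [_ <-] := eP j; ring.
have t0 : t != 0.
  apply/eqP => t0; move: tt; rewrite t0 -(scale0r 0) innerZl; lra.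
have [f fE] := isometry_orthogonal R 9 t t0.
have : (#|'I_256| <= 252)%N.
  apply: (delsarte_bound R _ (4 / 5) (fun i => f (u i))) => [|i|i j ij].
  - lra.
  - rewrite fE // uE Xnorm //; case: (eP i) => -[] -> _; lra.
  rewrite fE // uE.
  have /(Xdot _ _ (gX i) (gX j)) gij : g i != g j by rewrite (inj_eq g_inj).
  (* Up to sign the product of [g i] and [g j] is 1/5 or 3/5; subtracting 1/5 leaves -4/5, -2/5, 0
     or 2/5, the values allowed for [q = 4/5]. *)
  have [[->|->] _] := eP i; have [[->|->] _] := eP j; case: gij => ->;
    do [by apply: Or41; lra|by apply: Or42; lra|by apply: Or43; lra
       |by apply: Or44; lra].
by rewrite card_ord.
Qed.
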